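(* Let $A:\mathbb R\to\mathbb R^{n\times n}$ be continuous with $\sup_{t\in\mathbb R}\|A(t)\|=\mu<\infty$; let $f:\mathbb R\times\mathbb R^n\times\mathbb R^n\to\mathbb R^n$ be continuous in its first argument, with $f(t,0,0)=0$ for all $t\in\mathbb R$ and $\|f(t,y_1,w_1)-f(t,y_2,w_2)\|\le l(\|y_1-y_2\|+\|w_1-w_2\|)$ for all $t,y_1,y_2,w_1,w_2$; let $x'=A(t)x$ have an exponential dichotomy on $\mathbb R$ with constants $K,\sigma>0$; let $\|f(t,0,0)\|<h$ for all $t\in\mathbb R$ and some $h>0$; let $\frac{2KL}{\sigma}<1$, where $L=2\sup_{t\in\mathbb R}\|U(t)\|\,l$; and let $lM\theta[1+M(1+l\theta)e^{Ml\theta}]<m$, where $M=e^{\mu\theta}$, $m=e^{-\mu\theta}$. Then there exists a unique solution $z(t)$, bounded on $\mathbb R$, of the reduced system $$u'=B_+(t)u+g_+(t,z(t),z(\beta(t))),\qquad v'=B_-(t)v+g_-(t,z(t),z(\beta(t))),\qquad z=(u,v),$$ and $$\|z(t)\|\le\frac{2KH}{\sigma-2KL},\qquad t\in\mathbb R,$$ where $H=\sup_{t\in\mathbb R}\|U(t)\|\,h$.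
   Context: $\|\cdot\|$ is the Euclidean norm and the induced operator norm. $(\theta_i)_{i\in\mathbb Z}$ is a strictly increasing real sequence with $|\theta_i|\to\infty$ as $|i|\to\infty$ and $\theta_{i+1}-\theta_i\le\theta$ for all $i$, where $\theta>0$; $\beta(t)=\theta_i$ for $\theta_i\le t<\theta_{i+1}$. Exponential dichotomy: for a fundamental matrix $X(t)$ of $x'=A(t)x$ there is a projection $P$ with $\|X(t)PX^{-1}(s)\|\le Ke^{-\sigma(t-s)}$ for $t\ge s$ and $\|X(t)(I-P)X^{-1}(s)\|\le Ke^{-\sigma(s-t)}$ for $t\le s$. Reduced system: using Gram–Schmidt orthogonalization of the columns of $X(t)$, the equation $y'=A(t)y+f(t,y(t),y(\beta(t)))$ is reduced by the transformation $y=U(t)z$, where $U(t)$ is a Lyapunov matrix, to the displayed system with $u\in\mathbb R^k$, $v\in\mathbb R^{n-k}$, where $\operatorname{diag}\{B_+(t),B_-(t)\}=U^{-1}(t)A(t)U(t)$ and $(g_+(t,z(t),z(\beta(t))),g_-(t,z(t),z(\beta(t))))=f(t,U(t)z(t),U(\beta(t))z(\beta(t)))$. The Lipschitz condition $\|g_+(t,z_1,w_1)-g_+(t,z_2,w_2)\|+\|g_-(t,z_1,w_1)-g_-(t,z_2,w_2)\|\le L(\|z_1-z_2\|+\|w_1-w_2\|)$ holds with $L=2\sup_{t\in\mathbb R}\|U(t)\|\,l$. The fundamental matrices $U(t,s)$, $V(t,s)$ (two arguments, not to be confused with $U(t)$) of $u'=B_+(t)u$, $v'=B_-(t)v$, normalized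 by $U(s,s)=I$, $V(s,s)=I$, satisfy $\|U(t,s)\|\le Ke^{-\sigma(t-s)}$ for $t\ge s$ and $\|V(t,s)\|\le Ke^{-\sigma(s-t)}$ for $t\le s$. A solution on $\mathbb R$ is a continuous function on $\mathbb R$, differentiable except possibly at the points $\theta_i$ (where the right derivative exists), satisfying the system on every $(\theta_i,\theta_{i+1})$ and with right derivatives at the $\theta_i$. *)

(* Defs.v *)
From HB Require Import structures.
From mathcomp Require Import all_boot all_order all_algebra.
From mathcomp Require Import all_classical all_reals all_analysis.

Set Implicit Arguments.
Unset Strict Implicit.
Unset Printing Implicit Defensive.

Import Order.TTheory GRing.Theory Num.Theory.
Import numFieldNormedType.Exports.

Local Open Scope classical_set_scope.
Local Open Scope ring_scope.

(* The library norm `|x| on matrices is the max norm; it is used below only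
   through the topology it induces (continuity, derivatives), which is the
   Euclidean one.  All estimates use enorm and opnorm. *)
Definition enorm (R : realType) (n : nat) (x : 'cV[R]_n) : R :=
  Num.sqrt (\sum_(i < n) x i 0 ^+ 2).

Definition opnorm (R : realType) (m n : nat) (A : 'M[R]_(m, n)) : R :=
  sup [set enorm (A *m x) | x in [set x : 'cV[R]_n | enorm x <= 1]].

Definition mx_bounded (R : realType) (m n : nat) (F : R -> 'M[R]_(m, n)) : Prop :=
  has_ubound (range (fun t : R => opnorm (F t))).

(* Meaningful when mx_bounded F holds: sup of an unbounded set is 0. *)
Definition sup_opnorm (R : realType) (m n : nat) (F : R -> 'M[R]_(m, n)) : R :=
  sup (range (fun t : R => opnorm (F t))).

Definition fundamental_matrix (R : realType) (n : nat)
    (A X : R -> 'M[R]_n) : Prop :=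
  forall t : R, is_derive t 1 X (A t *m X t) /\ X t \in unitmx.

Definition transition_matrix (R : realType) (n : nat)
    (A : R -> 'M[R]_n) (Phi : R -> R -> 'M[R]_n) : Prop :=
  forall s : R, fundamental_matrix A (fun t => Phi t s) /\ Phi s s = 1%:M.

Definition exponential_dichotomy (R : realType) (n : nat)
    (A : R -> 'M[R]_n) (K sigma : R) : Prop :=
  exists X : R -> 'M[R]_n, fundamental_matrix A X /\
  exists P : 'M[R]_n,
    [/\ P *m P = P,
        forall t s : R, s <= t ->
          opnorm (X t *m P *m invmx (X s)) <= K * expR (- sigma * (t - s)) &
        forall t s : R, t <= s ->
          opnorm (X t *m (1%:M - P) *m invmx (X s))
            <= K * expR (- sigma * (s - t))].

Definition Lyapunov_matrix (R : realType) (n : nat) (U : R -> 'M[R]_n) : Prop :=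
  (forall t : R, derivable U t 1) /\ continuous (derive1 U) /\
  (forall t : R, U t \in unitmx) /\
  mx_bounded U /\ mx_bounded (fun t => invmx (U t)) /\ mx_bounded (derive1 U).

Definition switching_sequence (R : realType) (theta : int -> R) : Prop :=
  {homo theta : i j / i < j} /\
  (forall M : R, exists N : nat, forall i : int, (N <= `|i|)%N -> M <= `|theta i|).

Definition switching_function (R : realType) (theta : int -> R) (beta : R -> R) : Prop :=
  forall (i : int) (t : R), theta i <= t < theta (i + 1) -> beta t = theta i.

Definition is_right_derivative (R : realType) (n : nat)
    (z : R -> 'cV[R]_n) (t : R) (d : 'cV[R]_n) : Prop :=
  h^-1 *: (z (t + h) - z t) @[h --> (0 : R)^'+] --> d.

Definition solution_on_R (R : realType) (n : nat) (theta : int -> R) (beta : R -> R)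
    (F : R -> 'cV[R]_n -> 'cV[R]_n -> 'cV[R]_n) (z : R -> 'cV[R]_n) : Prop :=
  [/\ continuous z,
      forall (i : int) (t : R), theta i < t < theta (i + 1) ->
        is_derive t 1 z (F t (z t) (z (beta t))) &
      forall i : int,
        is_right_derivative z (theta i)
          (F (theta i) (z (theta i)) (z (beta (theta i))))].

Definition reduced_field (R : realType) (k p : nat)
    (Bp : R -> 'M[R]_k) (Bm : R -> 'M[R]_p)
    (gp : R -> 'cV[R]_(k + p) -> 'cV[R]_(k + p) -> 'cV[R]_k)
    (gm : R -> 'cV[R]_(k + p) -> 'cV[R]_(k + p) -> 'cV[R]_p)
    (t : R) (z w : 'cV[R]_(k + p)) : 'cV[R]_(k + p) :=
  let u := usubmx z in
  let v := dsubmx z in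
  col_mx (Bp t *m u + gp t z w) (Bm t *m v + gm t z w).

Definition bounded_on_R (R : realType) (n : nat) (z : R -> 'cV[R]_n) : Prop :=
  exists C : R, forall t : R, enorm (z t) <= C.

(* Main.v *)
Require Import Defs.
From HB Require Import structures.
From mathcomp Require Import all_boot all_order all_algebra.
From mathcomp Require Import all_classical all_reals all_analysis.
From mathcomp Require Import ring lra.
Import Order.TTheory GRing.Theory Num.Theory.
Import numFieldNormedType.Exports.
Local Open Scope classical_set_scope.
Local Open Scope ring_scope.

(* Since f(t,0,0) = 0, the zero function is a solution and satisfies the bound,
   so everything is in uniqueness. If |z| <= Z on R, then |g| <= L Z along z, and
   letting the initial time tend to -oo for u and to +oo for v in the variation of
   constants formula gives |u|, |v| <= K L Z / sigma. Hence |z| <= (2 K L / sigma) Z,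
   and the least bound Z is 0. *)

(** * Euclidean norm and induced operator norm *)

Lemma enorm_ge0 {R : realType} {n : nat} (x : 'cV[R]_n) : 0 <= enorm x.
Proof. exact: sqrtr_ge0. Qed.

Lemma sqr_enorm {R : realType} {n : nat} (x : 'cV[R]_n) :
  enorm x ^+ 2 = \sum_(i < n) x i 0 ^+ 2.
Proof. by rewrite sqr_sqrtr// sumr_ge0// => i _; rewrite sqr_ge0. Qed.

Lemma enorm_eq0 {R : realType} {n : nat} (x : 'cV[R]_n) : enorm x = 0 -> x = 0.
Proof.
move=> x0; have /eqP := sqr_enorm x; rewrite x0 expr0n/= eq_sym.
rewrite psumr_eq0 => [/allP x2|i _]; last exact: sqr_ge0.
apply/colP => i; rewrite mxE; apply/eqP.
by have := x2 i (mem_index_enum _); rewrite sqrf_eq0.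
Qed.

Lemma enorm0 {R : realType} {n : nat} : enorm (0 : 'cV[R]_n) = 0.
Proof. by rewrite /enorm big1 ?sqrtr0// => i _; rewrite mxE expr0n. Qed.

Lemma enormZ {R : realType} {n : nat} (a : R) (x : 'cV[R]_n) :
  enorm (a *: x) = `|a| * enorm x.
Proof.
rewrite /enorm -sqrtr_sqr -sqrtrM ?sqr_ge0//; congr Num.sqrt.
by rewrite mulr_sumr; apply: eq_bigr => i _; rewrite mxE exprMn.
Qed.

(** Cauchy-Schwarz. The vector [b w - a x], with [a] and [b] the norms of [w] and [x], has squared
    norm 2ab(ab - s), where s is the inner product. This is nonnegative and can be divided by 2ab
    unless one of the vectors vanishes. *)
Lemma dot_le_enorm {R : realType} {n : nat} (w x : 'cV[R]_n) :
  \sum_(i < n) w i 0 * x i 0 <= enorm w * enorm x.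
Proof.
set a := enorm w; set b := enorm x; set s := \sum_(_ < _) _.
have : 0 <= \sum_(i < n) (b * w i 0 - a * x i 0) ^+ 2.
  by rewrite sumr_ge0// => i _; exact: sqr_ge0.
have -> : \sum_(i < n) (b * w i 0 - a * x i 0) ^+ 2 =
    b ^+ 2 * a ^+ 2 - 2 * (a * b) * s + a ^+ 2 * b ^+ 2.
  rewrite [in X in X * _ - _ + _]/b [a ^+ 2 in X in X - _]sqr_enorm.
  rewrite [b ^+ 2 in X in _ + X]sqr_enorm !mulr_sumr -sumrB -big_split/=.
  by apply: eq_bigr => i _; rewrite -/b; ring.
have [a0 _|aN0] := eqVneq a 0.
  by rewrite a0 mul0r /s big1// => i _; rewrite (enorm_eq0 _ a0) mxE mul0r.
have [b0 _|bN0 H] := eqVneq b 0.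
  by rewrite b0 mulr0 /s big1// => i _; rewrite (enorm_eq0 _ b0) mxE mulr0.
have ab : 0 < a * b by rewrite mulr_gt0// lt_neqAle eq_sym ?aN0 ?bN0 enorm_ge0.
rewrite -(ler_pM2l ab); nra.
Qed.

Lemma ler_enormD {R : realType} {n : nat} (x y : 'cV[R]_n) :
  enorm (x + y) <= enorm x + enorm y.
Proof.
rewrite -(@ler_pXn2r _ 2)// ?nnegrE ?addr_ge0 ?enorm_ge0//.
have -> : enorm (x + y) ^+ 2 =
    enorm x ^+ 2 + 2 * (\sum_(i < n) x i 0 * y i 0) + enorm y ^+ 2.
  rewrite !sqr_enorm mulr_sumr -!big_split/=; apply: eq_bigr => i _.
  by rewrite mxE; ring.
have := dot_le_enorm x y; nra.
Qed.

Lemma ler_enormB {R : realType} {n : nat} (x y : 'cV[R]_n) :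
  enorm x <= enorm (x - y) + enorm y.
Proof. by rewrite -{1}(subrK y x) ler_enormD. Qed.

Lemma enorm_col_mx {R : realType} {k p : nat} (u : 'cV[R]_k) (v : 'cV[R]_p) :
  enorm (col_mx u v) ^+ 2 = enorm u ^+ 2 + enorm v ^+ 2.
Proof.
rewrite !sqr_enorm big_split_ord/=; congr (_ + _).
  by apply: eq_bigr => i _; rewrite col_mxEu.
by apply: eq_bigr => i _; rewrite col_mxEd.
Qed.

Lemma enorm_le_col_mxl {R : realType} {k p : nat} (u : 'cV[R]_k) (v : 'cV[R]_p) :
  enorm u <= enorm (col_mx u v).
Proof.
rewrite -(@ler_pXn2r _ 2)// ?nnegrE ?enorm_ge0// enorm_col_mx.
by rewrite lerDl sqr_ge0.
Qed.

Lemma enorm_le_col_mxr {R : realType} {k p : nat} (u : 'cV[R]_k) (v : 'cV[R]_p) :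
  enorm v <= enorm (col_mx u v).
Proof.
rewrite -(@ler_pXn2r _ 2)// ?nnegrE ?enorm_ge0// enorm_col_mx.
by rewrite lerDr sqr_ge0.
Qed.

Lemma enorm_col_mx_le {R : realType} {k p : nat} (u : 'cV[R]_k) (v : 'cV[R]_p) :
  enorm (col_mx u v) <= enorm u + enorm v.
Proof.
rewrite -(@ler_pXn2r _ 2)// ?nnegrE ?addr_ge0 ?enorm_ge0// enorm_col_mx.
have := enorm_ge0 u; have := enorm_ge0 v; nra.
Qed.

(** The supremum in [opnorm] is a true least upper bound only once this set is known to be bounded.
    Cauchy-Schwarz applied to each row gives the Frobenius norm of [A] as a bound. *)
Lemma has_ubound_opnorm {R : realType} {m n : nat} (A : 'M[R]_(m, n)) :
  has_ubound [set enorm (A *m x) | x in [set x : 'cV[R]_n | enorm x <= 1]].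
Proof.
pose r i : 'cV[R]_n := (row i A)^T.
exists (Num.sqrt (\sum_(i < m) enorm (r i) ^+ 2)) => _ [x /= x1 <-].
rewrite ler_sqrt ?sumr_ge0// => [|i _]; last exact: sqr_ge0.
apply: ler_sum => i _; rewrite -real_normK ?num_real//.
have normAx : `|(A *m x) i 0| <= enorm (r i) * enorm x.
  have Ax y : (A *m y) i 0 = \sum_(j < n) r i j 0 * y j 0.
    by rewrite mxE; apply: eq_bigr => j _; rewrite !mxE.
  (* [dot_le_enorm] is one-sided; applying it to [- x] as well bounds the absolute value. *)
  have dotN : - (A *m x) i 0 <= enorm (r i) * enorm x.
    have := dot_le_enorm (r i) (- x).
    by rewrite -Ax mulmxN mxE -[- x]scaleN1r enormZ normrN1 mul1r.
  by rewrite ler_norml lerNl dotN Ax dot_le_enorm.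
rewrite ler_pXn2r// ?nnegrE ?enorm_ge0//; apply: (le_trans normAx).
by rewrite ler_piMr// enorm_ge0.
Qed.

Lemma opnorm_ge0 {R : realType} {m n : nat} (A : 'M[R]_(m, n)) : 0 <= opnorm A.
Proof.
apply: ub_le_sup; first exact: has_ubound_opnorm.
by exists 0; rewrite /= ?mulmx0 enorm0.
Qed.

Lemma enorm_mulmx {R : realType} {m n : nat} (A : 'M[R]_(m, n)) (x : 'cV[R]_n) :
  enorm (A *m x) <= opnorm A * enorm x.
Proof.
have [x0|xN0] := eqVneq (enorm x) 0.
  by rewrite (enorm_eq0 _ x0) mulmx0 !enorm0 mulr0.
have x_gt0 : 0 < enorm x by rewrite lt_neqAle eq_sym xN0 enorm_ge0.
have : enorm (A *m ((enorm x)^-1 *: x)) <= opnorm A.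
  apply: ub_le_sup; first exact: has_ubound_opnorm.
  by exists ((enorm x)^-1 *: x) => //=; rewrite enormZ gtr0_norm ?invr_gt0// mulVf.
by rewrite -scalemxAr enormZ gtr0_norm ?invr_gt0// ler_pdivrMl// mulrC.
Qed.

Lemma le_sup_opnorm {R : realType} {m n : nat} (F : R -> 'M[R]_(m, n)) (t : R) :
  mx_bounded F -> opnorm (F t) <= sup_opnorm F.
Proof. by move=> Fb; apply: ub_le_sup => //; exists t. Qed.

(** * Derivatives of matrix-valued functions *)

Lemma is_derive_mxP {R : realType} {m n : nat} (M : R -> 'M[R]_(m, n)) (t : R)
    (dM : 'M[R]_(m, n)) :
  is_derive t 1 M dM <-> forall i j, is_derive t 1 (fun s => M s i j) (dM i j).
Proof.
split=> [[Mt <-] i j|dMt].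
  rewrite derive_mx// mxE; apply: DeriveDef => //.
  exact: (derivable_mxP M t 1).1.
have Mt : derivable M t 1.
  by apply/derivable_mxP => i j; case: (dMt i j).
apply: DeriveDef => //; apply/matrixP => i j; rewrite derive_mx// mxE.
by case: (dMt i j).
Qed.

Lemma is_derive_mulmx {R : realType} {m n p : nat}
    {A : R -> 'M[R]_(m, n)} {B : R -> 'M[R]_(n, p)} {t : R}
    {dA : 'M[R]_(m, n)} {dB : 'M[R]_(n, p)} :
  is_derive t 1 A dA -> is_derive t 1 B dB ->
  is_derive t 1 (fun s => A s *m B s) (dA *m B t + A t *m dB).
Proof.
move=> /is_derive_mxP At /is_derive_mxP Bt; apply/is_derive_mxP => i j.
have -> : (fun s => (A s *m B s) i j) =
    \sum_(k < n) ((fun s => A s i k) * (fun s => B s k j)).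
  by apply/funext => s; rewrite mxE fct_sumE.
apply: is_derive_eq.
rewrite !mxE -big_split/=; apply: eq_bigr => k _.
by rewrite /GRing.scale/= addrC [B _ _ _ * _]mulrC.
Qed.

Lemma derivable_prod {R : realType} {I : Type} (s : seq I) (F : I -> R -> R)
    (t : R) :
  (forall i, derivable (F i) t 1) ->
  derivable (fun x => \prod_(i <- s) F i x) t 1.
Proof.
move=> dF; elim: s => [|i s IHs].
  by under eq_fun do rewrite big_nil; exact: derivable_cst.
by under eq_fun do rewrite big_cons; exact: derivableM.
Qed.

Lemma derivable_bigsum {R : realType} {I : Type} (s : seq I) (F : I -> R -> R)
    (t : R) :
  (forall i, derivable (F i) t 1) ->
  derivable (fun x => \sum_(i <- s) F i x) t 1.
Proof.
move=> dF; elim: s => [|i s IHs].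
  by under eq_fun do rewrite big_nil; exact: derivable_cst.
by under eq_fun do rewrite big_cons; exact: derivableD.
Qed.

(** By the Leibniz expansion the determinant is a polynomial in the entries. *)
Lemma derivable_det {R : realType} {n : nat} (X : R -> 'M[R]_n) (t : R) :
  derivable X t 1 -> derivable (fun s => \det (X s)) t 1.
Proof.
move=> /derivable_mxP dX; apply: derivable_bigsum => s.
by apply: derivableM; [exact: derivable_cst|apply: derivable_prod => i].
Qed.

(** By Cramer's formula each entry of the inverse is a cofactor divided by the determinant, and a
    cofactor is a signed determinant of a minor. *)
Lemma derivable_invmx {R : realType} {n : nat} (X : R -> 'M[R]_n) (t : R) :
  (forall s, X s \in unitmx) -> derivable X t 1 ->
  derivable (fun s => invmx (X s)) t 1.
Proof.
move=> uX dX; apply/derivable_mxP => i j.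
have -> : (fun s => invmx (X s) i j) = (fun s => (\det (X s))^-1) *
    ((fun=> (-1) ^+ (j + i)) * (fun s => \det (row' j (col' i (X s))))).
  by apply/funext => s; rewrite /invmx uX !mxE.
apply: derivableM.
  apply: derivableV; last exact: derivable_det.
  by have := uX t; rewrite unitmxE unitfE.
apply: derivableM; first exact: derivable_cst.
apply: derivable_det; apply/derivable_mxP => a b.
under eq_fun do rewrite !mxE.
exact: (derivable_mxP X t 1).1.
Qed.

(** Differentiability is known from Cramer's formula, so the product rule applies to the constant
    function [invmx (X s) *m X s], and the resulting equation is solved for the derivative of the
    inverse. *)
Lemma is_derive_invmx {R : realType} {n : nat} {X : R -> 'M[R]_n} {t : R}
    {dX : 'M[R]_n} :
  (forall s, X s \in unitmx) -> is_derive t 1 X dX ->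
  is_derive t 1 (fun s => invmx (X s)) (- (invmx (X t) *m dX *m invmx (X t))).
Proof.
move=> uX dXt; have /derivableP dY : derivable (fun s => invmx (X s)) t 1.
  by apply: derivable_invmx => //; case: dXt.
apply: (is_derive_eq dY); set D := 'D_1 _ t.
have dYX : is_derive t 1 (fun s => invmx (X s) *m X s) 0.
  have -> : (fun s => invmx (X s) *m X s) = cst 1%:M.
    by apply/funext => s; rewrite mulVmx.
  exact: is_derive_cst.
have DX : D *m X t + invmx (X t) *m dX = 0.
  by have [_ <-] := is_derive_mulmx dY dXt; have [_ ->] := dYX.
by rewrite -(mulmxK (uX t) D) -mulNmx; congr (_ *m _); apply/eqP; rewrite -addr_eq0 DX.
Qed.

(** * Transition matrices *)

Lemma transition_matrixE {R : realType} {n : nat} {B : R -> 'M[R]_n}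
    {Phi : R -> R -> 'M[R]_n} :
  transition_matrix B Phi ->
  forall t s : R, Phi t s = Phi t 0 *m invmx (Phi s 0).
Proof.
move=> tPhi t s; have [fX _] := tPhi 0; have [fY Ys] := tPhi s.
have uX r : Phi r 0 \in unitmx by case: (fX r).
(* With X(r) = [Phi r 0], the product of X(r)^-1 and [Phi r s] is constant in r, because the two
   terms of its derivative, both built from the coefficient [B r], cancel. Its values at r = t and r
   = s are compared. *)
have cst i j : (invmx (Phi t 0) *m Phi t s) i j = invmx (Phi s 0) i j.
  rewrite -[invmx (Phi s 0)]mulmx1 -Ys.
  pose q (r : R) : R := (invmx (Phi r 0) *m Phi r s) i j.
  suff q0 (r : R) : is_derive r 1 q 0 by exact: (is_derive_0_is_cst t s q0).
  have [[dX _] [dY _]] := (fX r, fY r).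
  have /is_derive_mxP := is_derive_mulmx (is_derive_invmx uX dX) dY.
  move=> /(_ i j) dq; apply: (is_derive_eq dq).
  by rewrite mulNmx !mulmxA mulmxK ?uX// addNr mxE.
have -> : invmx (Phi s 0) = invmx (Phi t 0) *m Phi t s.
  by apply/matrixP => i j; rewrite cst.
by rewrite mulKVmx.
Qed.

(** [transition_matrix] prescribes a derivative in the first argument only. The factorization
    through [Phi _ 0] moves the second argument into an inverse, which can be differentiated;
    variation of constants needs this derivative. *)
Lemma is_derive_transition_matrixr {R : realType} {n : nat} {B : R -> 'M[R]_n}
    {Phi : R -> R -> 'M[R]_n} (t s : R) :
  transition_matrix B Phi -> is_derive s 1 (Phi t) (- (Phi t s *m B s)).
Proof.
move=> tPhi; have [fX _] := tPhi 0; have [dX _] := fX s.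
have uX r : Phi r 0 \in unitmx by case: (fX r).
have -> : Phi t = fun r => Phi t 0 *m invmx (Phi r 0).
  by apply/funext => r; exact: transition_matrixE.
have := is_derive_mulmx (is_derive_cst (Phi t 0) s 1) (is_derive_invmx uX dX).
move=> /is_derive_eq; apply.
by rewrite mul0mx add0r mulmxN !mulmxA mulmxK.
Qed.

(** * Continuity of matrix products and of blocks *)

Lemma continuous_mulmx_entry {R : realType} {m n p : nat}
    {A : R -> 'M[R]_(m, n)} {B : R -> 'M[R]_(n, p)} :
  continuous A -> continuous B ->
  forall i j, continuous (fun t => (A t *m B t) i j).
Proof.
move=> cA cB i j; under eq_fun do rewrite mxE.
apply: continuous_big => [|k _]; first exact: add_continuous.
move=> t; apply: cvgM.
  by apply: (@continuous_comp _ _ _ A (fun M => M i k)); [exact: cA|exact: coord_continuous].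
by apply: (@continuous_comp _ _ _ B (fun M => M k j)); [exact: cB|exact: coord_continuous].
Qed.

Lemma usubmx_continuous {R : realType} {m1 m2 n : nat} :
  continuous (@usubmx R m1 m2 n).
Proof.
move=> M s /nbhs_ballP[e e0 es]; apply/nbhs_ballP; exists e => // N [_ MN].
by apply: es; split=> // i j; rewrite !mxE; exact: MN.
Qed.

Lemma dsubmx_continuous {R : realType} {m1 m2 n : nat} :
  continuous (@dsubmx R m1 m2 n).
Proof.
move=> M s /nbhs_ballP[e e0 es]; apply/nbhs_ballP; exists e => // N [_ MN].
by apply: es; split=> // i j; rewrite !mxE; exact: MN.
Qed.

(** * Monotonicity and increments across the switching times *)

Lemma switching_sequence_exhausts {R : realType} {theta : int -> R} (a b : R) :
  switching_sequence theta ->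
  exists N : nat, theta (- N%:Z) <= a /\ b <= theta N%:Z.
Proof.
move=> [theta_incr theta_unb].
have theta_le : {homo theta : i j / i <= j} by exact/ltW_homo.
(* Only the absolute values of [theta N] and [theta (- N)] are known to be large. Since [C] is
   strictly larger than the absolute value of [theta 0], monotonicity of [theta] forces the first to
   be at least [C] and the second at most [- C]. *)
pose C := `|theta 0| + `|a| + `|b| + 1.
have [N thetaN] := theta_unb C; exists N.
have := thetaN N%:Z (leqnn _); have := thetaN (- N%:Z).
rewrite abszN => /(_ (leqnn _)).
have := theta_le 0 N%:Z isT.
have := theta_le (- N%:Z) 0; rewrite oppr_le0 => /(_ isT).
have := ler_norm (theta 0); have := lerNnormlW (lexx `|theta 0|).
have := ler_norm b; have := lerNnormlW (lexx `|a|).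
have := normr_ge0 a; have := normr_ge0 b; rewrite /C.
move: `|a| `|b| `|theta 0| => na nb n0.
case: (ger0P (theta N%:Z)) => _; case: (ger0P (theta (- N%:Z))) => _; split; lra.
Qed.

(** No derivative is available at the switching times. On each closed interval between consecutive
    ones, the sign of the derivative inside and continuity up to the endpoints suffice; finitely
    many such intervals cover [a, b] and are glued. *)
Lemma piecewise_ndecr {R : realType} {theta : int -> R} {f : R -> R} {a b : R} :
  switching_sequence theta -> continuous f ->
  (forall (i : int) (t : R), theta i < t < theta (i + 1) -> a < t < b ->
     exists2 d, is_derive t 1 f d & 0 <= d) ->
  a <= b -> f a <= f b.
Proof.
move=> htheta cf df ab.
(* Monotonicity on the intersection of [l, r] with [a, b], so that switching intervals sticking out
   of [a, b] need no separate treatment. *)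
pose mono l r := forall x y, a <= x -> y <= b -> l <= x -> x <= y -> y <= r ->
  f x <= f y.
have glue l c r : mono l c -> mono c r -> mono l r.
  move=> lc cr x y ax yb lx xy yr.
  have [cx|xc] := leP c x; first exact: cr.
  have [yc|cy] := leP y c; first exact: lc.
  apply: (@le_trans _ _ (f c)).
    by apply: lc => //; [exact: le_trans (ltW cy) yb|exact: ltW].
  by apply: cr => //; [exact: le_trans ax (ltW xc)|exact: ltW].
have step i : mono (theta i) (theta (i + 1)).
  move=> x y ax yb lx xy yr.
  have dxy t : t \in `]x, y[ -> exists2 d, is_derive t 1 f d & 0 <= d.
    rewrite in_itv/= => /andP[xt ty]; apply: (df i).
      by rewrite (le_lt_trans lx xt) (lt_le_trans ty yr).
    by rewrite (le_lt_trans ax xt) (lt_le_trans ty yb).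
  apply: (@ger0_derive1_ndecr _ f x y) => // [t /dxy[d []]//|t /dxy[d df1 d0]|].
    by rewrite derive1E; case: df1 => _ ->.
  exact: continuous_subspaceT.
(* Passing from N to N + 1 glues one switching interval on at each end. *)
have all N : mono (theta (- N%:Z)) (theta N%:Z).
  elim: N => [|N IHN].
    rewrite oppr0 => x y _ _ lx xy yr.
    by have -> : x = y by apply/le_anti; rewrite xy (le_trans yr lx).
  have sN : - (N.+1%:Z) + 1 = - N%:Z by rewrite -addn1 PoszD opprD subrK.
  apply: (glue _ (theta N%:Z)); last by rewrite -addn1 PoszD; exact: step.
  by have := step (- N.+1%:Z); rewrite sN => stepN; exact: glue stepN IHN.
have [N [aN bN]] := switching_sequence_exhausts a b htheta.
exact: (all N).
Qed.

(* The scalar statement is applied to [t |-> |w| * D t - <w, phi t>], with w the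
   increment of phi. *)
Lemma enorm_increment_le {R : realType} {n : nat} {theta : int -> R}
    {phi d : R -> 'cV[R]_n} {D dD : R -> R} {a b : R} :
  switching_sequence theta -> a <= b ->
  (forall i, continuous (fun t => phi t i 0)) ->
  (forall t : R, is_derive t 1 D (dD t)) ->
  (forall (i : int) (t : R), theta i < t < theta (i + 1) ->
     is_derive t 1 phi (d t)) ->
  (forall t, a <= t <= b -> enorm (d t) <= dD t) ->
  enorm (phi b - phi a) <= D b - D a.
Proof.
move=> htheta ab cphi dDt dphi dle; set w := phi b - phi a.
have cD : continuous D.
  by move=> t; apply/differentiable_continuous/derivable1_diffP; case: (dDt t).
have abW t : a < t < b -> a <= t <= b by move=> /andP[/ltW-> /ltW->].
(* The general argument ends with a division by [enorm w]. When this norm is 0, it remains to see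
   that [D] does not decrease, which holds because [dD] dominates a norm. *)
have [w0|wN0] := eqVneq (enorm w) 0.
  rewrite w0 subr_ge0; apply: (piecewise_ndecr htheta cD) => // i t _ /abW tab.
  by exists (dD t) => //; exact: le_trans (enorm_ge0 _) (dle _ tab).
pose c i : R -> R := cst (w i 0).
pose psi : R -> R :=
  cst (enorm w) * D - \sum_(i < n) (c i * (fun t => phi t i 0)).
have psiE t : psi t = enorm w * D t - \sum_(i < n) w i 0 * phi t i 0.
  by rewrite /psi fctE/= fct_sumE.
have cpsi : continuous psi.
  move=> t; apply: cvgB; first by apply: cvgM; [exact: cvg_cst|exact: cD].
  rewrite fct_sumE; apply: (@continuous_big _ _ +%R 0) => [|i _ {}t].
    exact: add_continuous.
  by apply: cvgM; [exact: cvg_cst|exact: cphi].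
have : psi a <= psi b.
  apply: (piecewise_ndecr htheta cpsi) => // i t it /abW tab.
  have dphit j := (is_derive_mxP _ _ _).1 (dphi _ _ it) j 0.
  exists (enorm w * dD t - \sum_(j < n) w j 0 * d t j 0).
    apply: is_derive_eq; rewrite /cst /= scaler0 addr0; congr (_ - _).
    by apply: eq_bigr => j _; rewrite scaler0 addr0.
  rewrite subr_ge0 (le_trans (dot_le_enorm _ _))//.
  by rewrite ler_wpM2l ?enorm_ge0// dle.
rewrite !psiE => psi_ab.
have : enorm w ^+ 2 = \sum_(i < n) w i 0 * phi b i 0 - \sum_(i < n) w i 0 * phi a i 0.
  by rewrite sqr_enorm -sumrB; apply: eq_bigr => i _; rewrite expr2 -mulrBr !mxE.
have w_gt0 : 0 < enorm w by rewrite lt_neqAle eq_sym wN0 enorm_ge0.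
move=> w2; rewrite -(ler_pM2l w_gt0); nra.
Qed.

(** * Bounded solutions of linear equations with exponentially decaying transition matrices *)

Lemma ler_of_exp_decay {R : realType} (x y c sigma : R) :
  0 < sigma -> 0 <= c ->
  (forall a, 0 <= a -> x <= c * expR (- sigma * a) + y) -> x <= y.
Proof.
move=> sigma0 c0 xle; rewrite leNgt; apply/negP => yx.
have xy : 0 < x - y by rewrite subr_gt0.
(* The limit as a tends to infinity is replaced by one explicit value. With e^(sigma a) at least 1 +
   sigma a, it yields (x - y)(1 + c / (x - y)) at most c, hence x - y at most 0. *)
pose a := c / (sigma * (x - y)).
have /xle : 0 <= a by rewrite divr_ge0// mulr_ge0// ltW.
have e0 : 0 < expR (sigma * a) by exact: expR_gt0.
rewrite mulNr expRN -lerBlDr ler_pdivlMr//.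
have sa : sigma * a = c / (x - y) by rewrite /a; field; rewrite !gt_eqF.
have := expR_ge1Dx (sigma * a); rewrite {1}sa => e1 H.
have : (x - y) * (1 + c / (x - y)) <= c.
  by apply: le_trans H; rewrite ler_pM2l.
by rewrite mulrDr mulr1 mulrCA divff ?gt_eqF// mulr1 gerDr leNgt xy.
Qed.

(** Supplies the majorants [D] used with variation of constants: explicit primitives of the
    exponential kernel bounds. *)
Lemma is_derive_expR_affine {R : realType} (c a b t : R) :
  is_derive t 1 (fun s => c * expR (a * s + b)) (c * (a * expR (a * t + b))).
Proof.
have daff : is_derive t 1 (fun s : R => a * s + b) a.
  have -> : (fun s : R => a * s + b) = a *: id + cst b by [].
  by apply: is_derive_eq; rewrite addr0 [LHS]mulr1.
have dexp := is_derive1_comp (is_derive_expR _) daff.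
have -> : (fun s => c * expR (a * s + b)) = c *: (expR \o (fun s => a * s + b)).
  by [].
by apply: is_derive_eq; rewrite [expR _ * a]mulrC.
Qed.

(* [s |-> Phi t s q(s)] has derivative [Phi t s g(s)] off the switching times:
   variation of constants without integrals. *)
Lemma variation_of_constants_le {R : realType} {n : nat} {theta : int -> R}
    {B : R -> 'M[R]_n} {Phi : R -> R -> 'M[R]_n} {q g : R -> 'cV[R]_n}
    {D dD : R -> R} {a b : R} (t : R) :
  switching_sequence theta -> transition_matrix B Phi -> continuous q ->
  (forall (i : int) (s : R), theta i < s < theta (i + 1) ->
     is_derive s 1 q (B s *m q s + g s)) ->
  a <= b -> (forall s : R, is_derive s 1 D (dD s)) ->
  (forall s, a <= s <= b -> opnorm (Phi t s) * enorm (g s) <= dD s) ->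
  enorm (Phi t b *m q b - Phi t a *m q a) <= D b - D a.
Proof.
move=> htheta tPhi cq dq ab dDt dle.
apply: (@enorm_increment_le _ _ _ (fun s => Phi t s *m q s)
  (fun s => Phi t s *m g s) _ _ _ _ htheta ab _ dDt).
- move=> i; apply: continuous_mulmx_entry => // s.
  apply/differentiable_continuous/derivable1_diffP.
  by case: (is_derive_transition_matrixr t s tPhi).
- move=> i s /dq dqs.
  apply: (is_derive_eq (is_derive_mulmx (is_derive_transition_matrixr t s tPhi) dqs)).
  by rewrite mulNmx mulmxDr mulmxA addKr.
- by move=> s /dle; exact: le_trans (enorm_mulmx _ _).
Qed.

(** The times t - a and t are compared. The initial term is at most K C e^(-sigma a) and disappears
    for large a because [q] is bounded; the forcing contributes at most K G / sigma, whatever a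
    is. *)
Lemma bounded_solution_stable {R : realType} {n : nat} {theta : int -> R}
    {B : R -> 'M[R]_n} {Phi : R -> R -> 'M[R]_n} {q g : R -> 'cV[R]_n}
    {K sigma G C : R} :
  switching_sequence theta -> transition_matrix B Phi -> continuous q ->
  (forall (i : int) (s : R), theta i < s < theta (i + 1) ->
     is_derive s 1 q (B s *m q s + g s)) ->
  0 < K -> 0 < sigma ->
  (forall t s : R, s <= t -> opnorm (Phi t s) <= K * expR (- sigma * (t - s))) ->
  (forall t, enorm (g t) <= G) -> (forall t, enorm (q t) <= C) ->
  forall t, enorm (q t) <= K * G / sigma.
Proof.
move=> htheta tPhi cq dq K0 sigma0 Phi_le gG qC t.
have C0 : 0 <= C := le_trans (enorm_ge0 _) (qC 0).
have G0 : 0 <= G := le_trans (enorm_ge0 _) (gG 0).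
apply: (@ler_of_exp_decay _ _ _ (K * C) sigma) => // [|a a0].
  by rewrite mulr_ge0// ltW.
have ta : t - a <= t by rewrite gerBl.
(* The majorant is D(s) = (K G / sigma) e^(-sigma (t - s)), a primitive of K e^(-sigma (t - s))
   G. *)
have := variation_of_constants_le t htheta tPhi cq dq ta
  (is_derive_expR_affine (K * G / sigma) sigma (- sigma * t)).
have [_ ->] := tPhi t; rewrite mul1mx => H.
apply: le_trans (ler_enormB _ (Phi t (t - a) *m q (t - a))) _.
rewrite addrC; apply: lerD.
  apply: le_trans (enorm_mulmx _ _) _.
  rewrite -mulrAC ler_pM ?opnorm_ge0 ?enorm_ge0//.
  by apply: le_trans (Phi_le _ _ ta) _; rewrite opprB addrC subrK.
apply: le_trans (H _) _ => [s /andP[_ st]|].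
  have -> : sigma * s + - sigma * t = - sigma * (t - s) by ring.
  have -> : K * G / sigma * (sigma * expR (- sigma * (t - s))) =
     K * expR (- sigma * (t - s)) * G by field; rewrite gt_eqF.
  by rewrite ler_pM ?opnorm_ge0 ?enorm_ge0 ?Phi_le.
(* D(t) equals K G / sigma, and D(t - a) is nonnegative. *)
rewrite mulNr subrr expR0 mulr1 gerBl.
by rewrite !mulr_ge0 ?expR_ge0 ?invr_ge0// ltW.
Qed.

(** The mirror image in time: the decay holds backwards, so t is compared with the later time t + a,
    where boundedness of [q] plays the part of the initial condition. *)
Lemma bounded_solution_unstable {R : realType} {n : nat} {theta : int -> R}
    {B : R -> 'M[R]_n} {Phi : R -> R -> 'M[R]_n} {q g : R -> 'cV[R]_n}
    {K sigma G C : R} :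
  switching_sequence theta -> transition_matrix B Phi -> continuous q ->
  (forall (i : int) (s : R), theta i < s < theta (i + 1) ->
     is_derive s 1 q (B s *m q s + g s)) ->
  0 < K -> 0 < sigma ->
  (forall t s : R, t <= s -> opnorm (Phi t s) <= K * expR (- sigma * (s - t))) ->
  (forall t, enorm (g t) <= G) -> (forall t, enorm (q t) <= C) ->
  forall t, enorm (q t) <= K * G / sigma.
Proof.
move=> htheta tPhi cq dq K0 sigma0 Phi_le gG qC t.
have C0 : 0 <= C := le_trans (enorm_ge0 _) (qC 0).
have G0 : 0 <= G := le_trans (enorm_ge0 _) (gG 0).
apply: (@ler_of_exp_decay _ _ _ (K * C) sigma) => // [|a a0].
  by rewrite mulr_ge0// ltW.
have ta : t <= t + a by rewrite lerDl.
(* Now D(s) = -(K G / sigma) e^(-sigma (s - t)); the minus sign makes it a primitive of the positive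
   bound K e^(-sigma (s - t)) G. *)
have := variation_of_constants_le t htheta tPhi cq dq ta
  (is_derive_expR_affine (- (K * G / sigma)) (- sigma) (sigma * t)).
have [_ ->] := tPhi t; rewrite mul1mx => H.
apply: le_trans (ler_enormB _ (Phi t (t + a) *m q (t + a))) _.
rewrite addrC; apply: lerD.
  apply: le_trans (enorm_mulmx _ _) _.
  rewrite -mulrAC ler_pM ?opnorm_ge0 ?enorm_ge0//.
  by apply: le_trans (Phi_le _ _ ta) _; rewrite [t + a]addrC addrK.
(* The increment runs from t to t + a, opposite to the difference to be bounded, hence the change of
   sign inside the norm. *)
rewrite -opprB -scaleN1r enormZ normrN1 mul1r.
apply: le_trans (H _) _ => [s /andP[ts _]|].
  have -> : - sigma * s + sigma * t = - sigma * (s - t) by ring.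
  have -> : - (K * G / sigma) * (- sigma * expR (- sigma * (s - t))) =
     K * expR (- sigma * (s - t)) * G by field; rewrite gt_eqF.
  by rewrite ler_pM ?opnorm_ge0 ?enorm_ge0 ?Phi_le.
rewrite [- sigma * t]mulNr addNr expR0 mulr1 opprK addrC mulNr gerBl.
by rewrite !mulr_ge0 ?expR_ge0 ?invr_ge0// ltW.
Qed.

(** * Contraction argument and the reduced system *)

Lemma eq0_of_contraction {R : realType} {n : nat} {z : R -> 'cV[R]_n}
    {rho : R} :
  rho < 1 -> bounded_on_R z ->
  (forall Z, (forall t, enorm (z t) <= Z) -> forall t, enorm (z t) <= rho * Z) ->
  forall t, z t = 0.
Proof.
move=> rho1 [C zC] contr t.
(* Boundedness of [z] makes this supremum an actual bound, so [contr] applies to it and returns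
   another bound, which cannot be smaller than [Z]. *)
pose Z := sup (range (fun t => enorm (z t))).
have zZ s : enorm (z s) <= Z.
  by apply: ub_le_sup; [exists C => _ [r _ <-]|exists s].
have ZrZ : Z <= rho * Z.
  apply: ge_sup; first by exists (enorm (z 0)), 0.
  by move=> _ [s _ <-]; exact: contr.
apply/enorm_eq0/le_anti; rewrite enorm_ge0 andbT.
by apply: le_trans (zZ t) _; nra.
Qed.

Theorem theorem2p8 (R : realType) (k p : nat)
  (theta : int -> R) (thbar : R) (beta : R -> R)
  (A : R -> 'M[R]_(k + p)) (mu : R)
  (f : R -> 'cV[R]_(k + p) -> 'cV[R]_(k + p) -> 'cV[R]_(k + p))
  (l K sigma h : R)
  (U : R -> 'M[R]_(k + p)) (Bp : R -> 'M[R]_k) (Bm : R -> 'M[R]_p)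
  (gp : R -> 'cV[R]_(k + p) -> 'cV[R]_(k + p) -> 'cV[R]_k)
  (gm : R -> 'cV[R]_(k + p) -> 'cV[R]_(k + p) -> 'cV[R]_p)
  (Uts : R -> R -> 'M[R]_k) (Vts : R -> R -> 'M[R]_p)
  (L H M m : R)
  (htheta : switching_sequence theta)
  (hthbar : 0 < thbar)
  (hstep : forall i : int, theta (i + 1) - theta i <= thbar)
  (hbeta : switching_function theta beta)
  (hAcont : continuous A)
  (hAbnd : mx_bounded A)
  (hmu : sup_opnorm A = mu)
  (hfcont : forall y w : 'cV[R]_(k + p), continuous (fun t : R => f t y w))
  (hf0 : forall t : R, f t 0 0 = 0)
  (hflip : forall (t : R) (y1 y2 w1 w2 : 'cV[R]_(k + p)),
     enorm (f t y1 w1 - f t y2 w2) <= l * (enorm (y1 - y2) + enorm (w1 - w2)))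
  (hK : 0 < K) (hsigma : 0 < sigma)
  (hdich : exponential_dichotomy A K sigma)
  (hh : 0 < h)
  (hfh : forall t : R, enorm (f t 0 0) < h)
  (hU : Lyapunov_matrix U)
  (hB : forall t : R, invmx (U t) *m A t *m U t = block_mx (Bp t) 0 0 (Bm t))
  (hg : forall (t : R) (z w : 'cV[R]_(k + p)),
     col_mx (gp t z w) (gm t z w) = f t (U t *m z) (U (beta t) *m w))
  (hUts : transition_matrix Bp Uts)
  (hVts : transition_matrix Bm Vts)
  (hUest : forall t s : R, s <= t ->
     opnorm (Uts t s) <= K * expR (- sigma * (t - s)))
  (hVest : forall t s : R, t <= s ->
     opnorm (Vts t s) <= K * expR (- sigma * (s - t)))
  (hL : L = 2 * sup_opnorm U * l)
  (hH : H = sup_opnorm U * h)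
  (hKL : 2 * K * L / sigma < 1)
  (hM : M = expR (mu * thbar))
  (hm : m = expR (- (mu * thbar)))
  (hsmall : l * M * thbar * (1 + M * (1 + l * thbar) * expR (M * l * thbar)) < m) :
  exists z : R -> 'cV[R]_(k + p),
    unique (fun y : R -> 'cV[R]_(k + p) =>
      solution_on_R theta beta (reduced_field Bp Bm gp gm) y /\ bounded_on_R y) z
    /\ forall t : R, enorm (z t) <= 2 * K * H / (sigma - 2 * K * L).

Proof.
have U_bdd : mx_bounded U by case: hU => _ [_ [_ []]].
set S := sup_opnorm U in hL hH *.
have S0 : 0 <= S := le_trans (opnorm_ge0 (U 0)) (le_sup_opnorm _ _ U_bdd).
have KLs : 2 * K * L < sigma by move: hKL; rewrite ltr_pdivrMr// mul1r.
(* For the zero solution the estimate says only that its right-hand side is nonnegative, which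
   follows from [S0] and [KLs]. *)
exists (fun=> 0); split; last first.
  move=> t; rewrite enorm0 hH divr_ge0 ?subr_ge0 ?(ltW KLs)//.
  by rewrite !mulr_ge0// ltW.
have F0 t : reduced_field Bp Bm gp gm t 0 0 = 0.
  rewrite /reduced_field; have := hg t 0 0; rewrite !mulmx0 hf0.
  rewrite -[X in _ = X -> _]col_mx0 => /eq_col_mx[-> ->].
  by rewrite -[X in usubmx X]col_mx0 -[X in dsubmx X]col_mx0 col_mxKu col_mxKd
    !mulmx0 !addr0 col_mx0.
split.
  split; last by exists 0 => t; rewrite enorm0.
  split; first by move=> t; exact: cvg_cst.
    by move=> i t _; rewrite F0; exact: is_derive_cst.
  move=> i; rewrite F0 /is_right_derivative.
  by under eq_fun do rewrite subrr scaler0; exact: cvg_cst.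
move=> z [[cz dz _] bz]; apply/funext => t; apply/esym; move: t.
have [l_lt0|l_ge0] := ltP l 0.
  (* A negative Lipschitz constant forces the space to be trivial. *)
  move=> t; apply/enorm_eq0/le_anti; rewrite enorm_ge0 andbT.
  have := le_trans (enorm_ge0 _) (hflip t (z t) 0 0 0).
  by rewrite !subr0 enorm0 addr0 nmulr_rge0.
apply: (@eq0_of_contraction _ _ _ (2 * K * L / sigma)) => // Z zZ t.
pose gz s := (gp s (z s) (z (beta s)), gm s (z s) (z (beta s))).
have Uz r s : enorm (U r *m z s) <= S * Z.
  apply: le_trans (enorm_mulmx _ _) _.
  by rewrite ler_pM ?opnorm_ge0 ?enorm_ge0 ?le_sup_opnorm.
(* Comparison with f(s, 0, 0) = 0. The two arguments z(s) and z(beta(s)) each contribute l S Z,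
   which accounts for the factor 2 in L = 2 S l. *)
have gLZ s : enorm (col_mx (gz s).1 (gz s).2) <= L * Z.
  rewrite hg -[X in enorm X]subr0 -[X in _ - X](hf0 s).
  apply: le_trans (hflip _ _ _ _ _) _; rewrite !subr0 hL.
  have -> : 2 * S * l * Z = l * (S * Z + S * Z) by ring.
  by rewrite ler_wpM2l// lerD.
have zE s : z s = col_mx (usubmx (z s)) (dsubmx (z s)) by rewrite vsubmxK.
have dz' i s : theta i < s < theta (i + 1) ->
    is_derive s 1 (fun r => usubmx (z r)) (Bp s *m usubmx (z s) + (gz s).1) /\
    is_derive s 1 (fun r => dsubmx (z r)) (Bm s *m dsubmx (z s) + (gz s).2).
  move=> /dz /is_derive_mxP dzs; split; apply/is_derive_mxP => a b.
    have := dzs (lshift p a) b; rewrite /reduced_field col_mxEu.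
    by under eq_fun do rewrite [z _]zE col_mxEu.
  have := dzs (rshift k a) b; rewrite /reduced_field col_mxEd.
  by under eq_fun do rewrite [z _]zE col_mxEd.
rewrite [z t]zE; apply: le_trans (enorm_col_mx_le _ _) _.
(* The stable and the unstable block each receive half of the contraction constant. *)
have -> : 2 * K * L / sigma * Z = K * (L * Z) / sigma + K * (L * Z) / sigma.
  by field; rewrite gt_eqF.
apply: lerD.
  apply: (bounded_solution_stable htheta hUts _ (fun i s H => (dz' i s H).1)
    hK hsigma hUest (C := Z)).
  - by move=> s; apply: (@continuous_comp _ _ _ z usubmx);
      [exact: cz|exact: usubmx_continuous].
  - by move=> s; exact: le_trans (enorm_le_col_mxl _ _) (gLZ s).
  - by move=> s; apply: le_trans (zZ s); rewrite [z s]zE col_mxKu enorm_le_col_mxl.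
apply: (bounded_solution_unstable htheta hVts _ (fun i s H => (dz' i s H).2)
    hK hsigma hVest (C := Z)).
- by move=> s; apply: (@continuous_comp _ _ _ z dsubmx);
    [exact: cz|exact: dsubmx_continuous].
- by move=> s; exact: le_trans (enorm_le_col_mxr _ _) (gLZ s).
- by move=> s; apply: le_trans (zZ s); rewrite [z s]zE col_mxKd enorm_le_col_mxr.
Qed.
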